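(* For every integer $n\ge 8$, $\bigl|\mathrm{LE}(n)\cap((n-1)!,\,n!]\bigr|<(n-3)!$.
   Context: All posets are finite. For a finite poset $P$, $\mathrm{ext}(P)$ denotes the number of linear extensions of $P$. For a positive integer $n$, $\mathrm{LE}(n)=\{\mathrm{ext}(P): P \text{ a poset with } |P|=n\}$. *)

(* Defs.v *)
From mathcomp Require Import all_boot all_order all_fingroup.
Set Implicit Arguments. Unset Strict Implicit. Unset Printing Implicit Defensive.

(* A poset on an n-element ground set, w.l.o.g. the ground set 'I_n, given by
   its order relation R (as a set of pairs (x,y) meaning x <=_P y). *)
Definition is_poset (n : nat) (R : {set 'I_n * 'I_n}) : bool :=
  [&& [forall x, (x, x) \in R],
      [forall x, forall y, ((x, y) \in R) && ((y, x) \in R) ==> (x == y)]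
    & [forall x, forall y, forall z,
         ((x, y) \in R) && ((y, z) \in R) ==> ((x, z) \in R)]].

Definition is_linext (n : nat) (R : {set 'I_n * 'I_n}) (s : {perm 'I_n}) : bool :=
  [forall x, forall y, ((x, y) \in R) ==> (s x <= s y)%N].

Definition ext (n : nat) (R : {set 'I_n * 'I_n}) : nat :=
  #|[set s : {perm 'I_n} | is_linext R s]|.

Definition in_LE (n m : nat) : bool :=
  [exists R : {set 'I_n * 'I_n}, is_poset R && (ext R == m)].

Definition card_LE_in (n a b : nat) : nat :=
  count (in_LE n) (iota a.+1 (b - a)).

(* Main.v *)
(**
Let S be the set of the m elements of P comparable to some other element.
Isolated elements can be inserted anywhere, so ext(P) = e * n!/m! with e the
number of linear extensions of S.  The graph of the relations a < b with a
minimal has no isolated vertex in S, hence has a spanning forest of stars with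
at least 2 vertices; a star with k vertices has probability 1/k to be respected
by a random order, so ext(P)/n! is at most the product of the 1/k_i, which is at
most 1/m.  If there are two stars or more and m >= 5, it is even at most
1/(m + 1); with one star, either P is a star, and ext(P) = n!/m, or it has a
further relation, and ext(P) <= n!/(2m).  So for ext(P) > (n - 1)! there is no
value with m = n, one value with m = n - 1, and for smaller m at most
(m - 1)! - floor(m!/n) values of e.
*)
Require Import Defs.
From mathcomp Require Import all_boot all_order all_fingroup.
From mathcomp Require Import zify.

Set Implicit Arguments. Unset Strict Implicit. Unset Printing Implicit Defensive.

(** * Splitting a star off a graph without isolated vertices *)

Lemma leq_add_mul a b : 1 < a -> 1 < b -> a + b <= b * a.
Proof. by case: a => [|[|a]] //; case: b => [|[|b]] // _ _; nia. Qed.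

Lemma ltn_add_mul a b : 1 < a -> 1 < b -> 5 <= a + b -> a + b < b * a.
Proof. by case: a => [|[|a]] //; case: b => [|[|b]] // _ _; nia. Qed.

Definition covered (T : finType) (g : rel T) (S : {set T}) : Prop :=
  {in S, forall x, exists2 y, y \in S & g x y}.

Lemma covered_card_gt1 (T : finType) (g : rel T) (S : {set T}) :
  irreflexive g -> S != set0 -> covered g S -> 1 < #|S|.
Proof.
move=> gI /set0Pn[x xS] covS; have [y yS gxy] := covS _ xS.
rewrite (cardD1 x) (cardD1 y) xS !inE yS.
by case: eqVneq gxy => [->|//]; rewrite gI.
Qed.

(* Either some vertex c has a pendant neighbour, and the star is c with all its
   pendant neighbours; or all degrees are at least 2, and for an edge cd the
   star is c with d and all vertices whose neighbourhood is {c, d}. *)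
Lemma covered_star (T : finType) (g : rel T) (S : {set T}) :
  symmetric g -> irreflexive g -> S != set0 -> covered g S ->
  exists c, exists A : {set T},
    [/\ c \in A, A \subset S, 1 < #|A|, {in A, forall a, a != c -> g c a}
      & covered g (S :\: A)].
Proof.
move=> gS gI S0 covS.
pose N x := [set y in S | g x y].
pose A c d := [set c; d] :|: [set y in S | N y \subset [set c; d]].
(* A vertex [x] outside [A c d] has a neighbour [z] outside {c, d}; since [x] is in turn a neighbour
   of [z], also [z] is outside [A c d]. *)
have cov_setD c d : covered g (S :\: A c d).
  move=> x; rewrite !inE !negb_or => /andP[/andP[/andP[xc xd]] nx xS].
  move: nx; rewrite xS /= => /subsetPn[z]; rewrite !inE negb_or.
  move=> /andP[zS gxz] /andP[zc zd]; exists z => //.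
  rewrite !inE !negb_or zc zd zS /= andbT; apply/subsetPn; exists x.
    by rewrite inE xS gS.
  by rewrite !inE negb_or xc.
have sub c d : c \in S -> d \in S -> A c d \subset S.
  move=> cS dS; apply/subsetP => y; rewrite !inE => /orP[/orP[]/eqP->//|].
  by case/andP.
have [/existsP[y /existsP[c /and3P[yS cS /eqP Ny]]]|none] :=
    boolP [exists y, exists c, [&& y \in S, c \in S & N y == [set c]]].
  have gyc : g y c by move: (set11 c); rewrite -Ny inE => /andP[].
  exists c, (A c c); split => //.
  - by rewrite !inE eqxx.
  - exact: sub.
  - rewrite (cardD1 c) (cardD1 y) !inE eqxx yS Ny /= setUid subxx orbT andbT.
    by case: eqVneq gyc => [->|//]; rewrite gI.
  - move=> a; rewrite !inE setUid orbb => + ac; rewrite (negPf ac) /=.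
    move=> /andP[aS /subsetP Na]; have [b bS gab] := covS _ aS.
    have := Na b; rewrite !inE bS gab => /(_ isT)/eqP bc.
    by rewrite gS -bc.
have /set0Pn[c cS] := S0; have [d dS gcd] := covS _ cS.
have dc : d != c by case: eqVneq gcd => [->|//]; rewrite gI.
exists c, (A c d); split => //.
- by rewrite !inE eqxx.
- exact: sub.
- by rewrite (cardD1 c) (cardD1 d) !inE !eqxx dc orbT.
move=> a; rewrite !inE => + ac; rewrite (negPf ac) /= => /orP[/eqP->//|].
move=> /andP[aS /subsetP Na].
(* Otherwise [d] is the only neighbour of [a], so [a] is pendant. *)
apply/negPn/negP => ngca; case/negP: none.
apply/existsP; exists a; apply/existsP; exists d; rewrite aS dS /=.
have Nad b : b \in S -> g a b -> b = d.
  move=> bS gab; have := Na b; rewrite !inE bS gab => /(_ isT)/orP[/eqP bc|/eqP//].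
  by move: ngca; rewrite gS -bc gab.
apply/eqP/setP => b; rewrite !inE; apply/andP/eqP => [[]|->]; first exact: Nad.
by have [b' b'S gab'] := covS _ aS; split=> //; rewrite -(Nad _ b'S gab').
Qed.

(** * Extremal elements in random orders *)

Definition dir_leq (b : bool) (i j : nat) : bool := if b then i <= j else j <= i.

Lemma dir_leq_anti b i j : dir_leq b i j -> dir_leq b j i -> i = j.
Proof. by rewrite /dir_leq; case: b => *; lia. Qed.

Lemma dir_leq_extremum (T : finType) b (A : {set T}) (f : T -> nat) c :
  c \in A -> exists2 a, a \in A & {in A, forall x, dir_leq b (f a) (f x)}.
Proof.
move=> cA; rewrite /dir_leq; case: b.
  by case: (arg_minnP f cA) => a aA H; exists a.
by case: (arg_maxnP f cA) => a aA H; exists a.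
Qed.

Section Permutations.

Variable n : nat.
Implicit Types (s t : {perm 'I_n}) (A S : {set 'I_n}) (F : pred {perm 'I_n}).

(** Minimum for [b = true], maximum for [b = false]: a star may have its center below or above its
    leaves. *)
Definition extremal b A (c : 'I_n) s := [forall a in A, dir_leq b (s c) (s a)].

(* Precomposing with the transposition (c a) moves the extremal element of A
   from a to c, so every element of A is extremal equally often. *)
Lemma card_extremal F b A c : c \in A ->
  {in A, forall a s, F (tperm c a * s)%g = F s} ->
  #|A| * #|[set s | F s & extremal b A c s]| = #|[set s | F s]|.
Proof.
move=> cA Finv.
have inj x y s : s x = s y :> nat -> x = y by move=> /val_inj/perm_inj.
have eq_a a : a \in A ->
    #|[set s | F s & extremal b A a s]| = #|[set s | F s & extremal b A c s]|.
  move=> aA; rewrite -!sum1_card (reindex_inj (mulgI (tperm c a))) /=.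
  apply: eq_bigl => s; rewrite !inE Finv //; congr (_ && _).
  have tA x : x \in A -> tperm c a x \in A by case: tpermP => // ->.
  rewrite /extremal permM tpermR.
  apply/forall_inP/forall_inP => H x xA; last by rewrite permM H // tA.
  by have := H _ (tA _ xA); rewrite permM tpermK.
rewrite -[RHS]sum1_card.
(* Double counting: each [s] has exactly one extremal element in [A]. *)
transitivity (\sum_(s | F s) \sum_(a in A | extremal b A a s) 1).
  rewrite (exchange_big_dep (mem A)) /= => [|i a _ /andP[]//].
  rewrite -sum_nat_const; apply: eq_bigr => a aA.
  rewrite -(eq_a a aA) -sum1_card; apply: eq_bigl => s.
  by rewrite inE aA.
apply: eq_big => s; rewrite ?inE // => Fs.
have [a aA Ha] := dir_leq_extremum b (fun x => nat_of_ord (s x)) cA.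
rewrite (bigD1 a) /=; last by rewrite aA; apply/forall_inP.
rewrite big1 ?addn0 // => a' /andP[/andP[a'A /forall_inP Ha']] /eqP[].
by apply: (inj _ _ s); apply: (dir_leq_anti (Ha' _ aA) (Ha _ a'A)).
Qed.

Lemma leq_card_pred (F G : pred {perm 'I_n}) : (forall s, F s -> G s) ->
  #|[set s | F s]| <= #|[set s | G s]|.
Proof. by move=> FG; apply/subset_leq_card/subsetP => s; rewrite !inE; apply: FG. Qed.

Lemma card_permT : #|[set s : {perm 'I_n} | true]| = n`!.
Proof.
by rewrite -[RHS]card_Sn; apply: eq_card => s; rewrite !inE.
Qed.

(** * Orders respecting a bipartite relation *)

Definition resp (E : rel 'I_n) S s :=
  [forall x in S, forall y in S, E x y ==> (s x <= s y)].

Definition sym_closure (E : rel 'I_n) : rel 'I_n := fun x y => E x y || E y x.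

Definition bipartite (E : rel 'I_n) := forall x y z, E x y -> ~~ E y z.

Section Bipartite.

Variable E : rel 'I_n.
Hypothesis Ebip : bipartite E.

Lemma sym_closureC : symmetric (sym_closure E).
Proof. by move=> x y; rewrite /sym_closure orbC. Qed.

Lemma sym_closure_irr : irreflexive (sym_closure E).
Proof.
by move=> x; rewrite /sym_closure orbb; apply/negP => Exx; case/negP: (Ebip x Exx).
Qed.

(** An edge leaving [c] excludes every edge entering [c]. *)
Lemma star_dir c A : {in A, forall a, a != c -> sym_closure E c a} ->
  exists b, {in A, forall a, a != c -> if b then E c a else E a c}.
Proof.
move=> H.
have [/existsP[y /andP[yA Ecy]]|none] := boolP [exists y, (y \in A) && E c y].
  exists true => a aA ac; case/orP: (H _ aA ac) => // Eac.
  by case/negP: (Ebip y Eac).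
exists false => a aA ac; case/orP: (H _ aA ac) => // Eca.
by case/negP: none; apply/existsP; exists a; rewrite aA.
Qed.

(** Respecting [E] on [S] makes [c] extremal in [A]. Transpositions inside [A] do not affect the
    condition on [S :\: A], so extremality of [c] costs a factor [#|A|]. *)
Lemma card_resp_star S A c : c \in A -> A \subset S ->
  {in A, forall a, a != c -> sym_closure E c a} ->
  #|A| * #|[set s | resp E S s]| <= #|[set s | resp E (S :\: A) s]|.
Proof.
move=> cA /subsetP sAS /star_dir[b Hb].
rewrite -(@card_extremal (resp E (S :\: A)) b A c cA); last first.
  move=> a aA s; apply: eq_forallb => x.
  have [xS|//] := boolP (x \in _); apply: eq_forallb => y.
  have [yS|//] := boolP (y \in _).
  have tD z : z \in S :\: A -> tperm c a z = z.
    by rewrite inE => /andP[zA _]; rewrite tpermD //; apply: contraNneq zA => <-.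
  by rewrite !permM !tD.
rewrite leq_mul2l; apply/orP; right; apply: leq_card_pred => s /forall_inP Hs.
apply/andP; split.
  apply/forall_inP => x; rewrite inE => /andP[_ xS].
  apply/forall_inP => y; rewrite inE => /andP[_ yS].
  exact: (forall_inP (Hs _ xS)).
apply/forall_inP => a aA; have [->|ac] := eqVneq a c.
  by rewrite /dir_leq; case: b {Hb}.
have := Hb _ aA ac; rewrite /dir_leq; case: b {Hb} => Ea.
  exact: (implyP (forall_inP (Hs _ (sAS _ cA)) _ (sAS _ aA))).
exact: (implyP (forall_inP (Hs _ (sAS _ aA)) _ (sAS _ cA))).
Qed.

(* Splitting off a star with a vertices divides the count by a, and
   a * b >= a + b for a, b >= 2. *)
Lemma card_resp_covered S : S != set0 -> covered (sym_closure E) S ->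
  #|S| * #|[set s | resp E S s]| <= n`!.
Proof.
have [k] := ubnP #|S|; elim: k S => // k IH S ltSk S0 covS.
have [c [A [cA sAS A2 starA covD]]] :=
  covered_star sym_closureC sym_closure_irr S0 covS.
have H := card_resp_star cA sAS starA.
have cSA : #|S| = #|A| + #|S :\: A| by rewrite -(cardsID A S) (setIidPr sAS).
have [D0|D0] := eqVneq (S :\: A) set0.
  move: cSA H; rewrite D0 cards0 addn0 => -> H; apply: (leq_trans H).
  rewrite -card_permT; exact: leq_card_pred.
have D2 := covered_card_gt1 sym_closure_irr D0 covD.
have := IH (S :\: A); rewrite cSA in ltSk *.
move=> /(_ ltac:(lia) D0 covD) H2.
apply: leq_trans H2; apply: leq_trans (leq_mul (leqnn #|S :\: A|) H).
rewrite mulnA leq_mul2r; apply/orP; right; exact: leq_add_mul.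
Qed.

(** If the star is not all of [S], it has a >= 2 vertices and leaves b >= 2, and a + b >= 5 makes a
    * b exceed a + b. *)
Lemma card_resp_covered_strict S : 5 <= #|S| -> covered (sym_closure E) S ->
  #|S|.+1 * #|[set s | resp E S s]| <= n`! \/
  exists2 c, c \in S & exists b,
    {in S, forall a, a != c -> if b then E c a else E a c}.
Proof.
move=> S5 covS; have S0 : S != set0 by rewrite -card_gt0; lia.
have [c [A [cA sAS A2 starA covD]]] :=
  covered_star sym_closureC sym_closure_irr S0 covS.
have H := card_resp_star cA sAS starA.
have cSA : #|S| = #|A| + #|S :\: A| by rewrite -(cardsID A S) (setIidPr sAS).
have [D0|D0] := eqVneq (S :\: A) set0.
  right; have SA : S = A.
    by apply/eqP; rewrite eqEsubset sAS -setD_eq0 D0 eqxx.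
  by exists c; rewrite SA //; apply: star_dir.
have D2 := covered_card_gt1 sym_closure_irr D0 covD.
left; apply: leq_trans (card_resp_covered D0 covD).
apply: leq_trans (leq_mul (leqnn #|S :\: A|) H).
by rewrite mulnA leq_mul2r cSA ltn_add_mul ?orbT // -cSA.
Qed.

End Bipartite.

(** * Inserting isolated elements *)

Section IsolatedElements.

Variables (S : {set 'I_n}) (P : pred {perm 'I_n}).
Hypothesis P_rel : forall s t,
  {in S &, forall x y, (s x <= s y) = (t x <= t y)} -> P s = P t.

(* The elements of l occupy the last positions, in this order. *)
Definition placed_last (l : seq 'I_n) s :=
  [seq nat_of_ord (s x) | x <- l] == iota (n - size l) (size l).

(* Swapping the adjacent positions v and v+1 when x sits in one of them does
   not affect the relative order of S. *)
Lemma card_placed_swap (l : seq 'I_n) x (v w : 'I_n) : x \notin S -> x \notin l ->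
  w = v.+1 :> nat -> w < n - size l ->
  #|[set s | [&& P s, placed_last l s & s x == v]]| =
  #|[set s | [&& P s, placed_last l s & s x == w]]|.
Proof.
move=> xS xl wv wl; rewrite -!sum1_card (reindex_inj (mulIg (tperm v w))) /=.
apply: eq_bigl => s; rewrite !inE permM.
have -> : (tperm v w (s x) == v) = (s x == w).
  by rewrite -{2}(tpermR v w) (inj_eq perm_inj).
have [sx|] := eqVneq (s x) w; last by rewrite !andbF.
rewrite !andbT; congr (_ && _).
  apply: P_rel => y z yS zS; rewrite !permM.
  have yw u : u \in S -> s u != w.
    by move=> uS; rewrite -sx (inj_eq perm_inj); apply: contraNneq xS => <-.
  (* Away from the value [w = v + 1], the swap only raises [v] by one, which preserves the order. *)
  have tv (u : 'I_n) : u != w ->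
      nat_of_ord (tperm v w u) = if nat_of_ord u == v then v.+1 else u.
    rewrite val_eqE => uw; case: eqVneq => [->|uv]; first by rewrite tpermL.
    by rewrite tpermD // eq_sym.
  have := yw _ yS; have := yw _ zS => szw syw; rewrite !tv //.
  move: szw syw; rewrite -!val_eqE /=.
  rewrite wv; move: (nat_of_ord (s y)) (nat_of_ord (s z)) (nat_of_ord v) => i j k.
  by case: (i =P k); case: (j =P k); lia.
have stab t : placed_last l t -> placed_last l (t * tperm v w)%g.
  move=> pl; rewrite /placed_last -(eqP pl); apply/eqP/eq_in_map => y yl.
  have : nat_of_ord (t y) \in [seq nat_of_ord (t x) | x <- l] by apply/map_f.
  rewrite (eqP pl) mem_iota => /andP[tyl _].
  have wty : w < t y := leq_trans wl tyl.
  have vty : v < t y by rewrite (leq_trans _ wty) // wv.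
  by rewrite permM tpermD // -val_eqE /= neq_ltn ?wty ?vty.
apply/idP/idP => [/stab|/stab//].
by rewrite -mulgA tperm2 mulg1.
Qed.

(** By adjacent swaps, [x] takes each of the [n - size l] free positions equally often; [x :: l]
    asks for the last of them. *)
Lemma card_placed_cons (l : seq 'I_n) x : x \notin S -> x \notin l -> size l < n ->
  #|[set s | P s & placed_last l s]| =
  (n - size l) * #|[set s | P s & placed_last (x :: l) s]|.
Proof.
move=> xS xl ln.
have ltv : (n - size l).-1 < n by lia.
pose c v := #|[set s | [&& P s, placed_last l s & s x == v]]|.
have placed_cons s :
    placed_last (x :: l) s = placed_last l s && (s x == Ordinal ltv).
  rewrite /placed_last /= -val_eqE /=.
  have -> : n - (size l).+1 = (n - size l).-1 by lia.
  by rewrite eqseq_cons prednK ?subn_gt0 // andbC.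
have cE k : k < n - size l -> forall v : 'I_n,
    v + k = (n - size l).-1 -> c v = c (Ordinal ltv).
  elim: k => [|k IH] kl v vk; first by congr c; apply/val_inj; rewrite /= -vk addn0.
  have vk' : v.+1 + k = (n - size l).-1 by rewrite -vk addnS.
  have ltw : v.+1 < n by lia.
  rewrite -(IH (ltnW kl) (Ordinal ltw) vk').
  by apply: card_placed_swap => //=; lia.
rewrite -sum1_card (partition_big (fun s : {perm 'I_n} => s x) predT) //=.
have -> : #|[set s | P s & placed_last (x :: l) s]| = c (Ordinal ltv).
  by apply: eq_card => s; rewrite !inE placed_cons.
have -> : (n - size l) * c (Ordinal ltv) = \sum_(v < n - size l) c (Ordinal ltv).
  by rewrite sum_nat_const card_ord.
rewrite (big_ord_widen n (fun=> c _)) ?leq_subr // [RHS]big_mkcond /=.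
apply: eq_bigr => v _; case: ltnP => vl.
  have vk : v + ((n - size l).-1 - v) = (n - size l).-1.
    by rewrite subnKC // -ltnS prednK // (leq_ltn_trans _ vl).
  rewrite -(cE _ _ v vk); last by rewrite -vk; lia.
  by rewrite sum1dep_card; apply: eq_card => s; rewrite !inE andbA.
(* The positions from [n - size l] on are held by [l], so [x] is never there. *)
rewrite big1 // => s; rewrite !inE => /andP[/andP[_ /eqP pl]] /eqP sx.
have : nat_of_ord (s x) \in iota (n - size l) (size l).
  by rewrite mem_iota sx vl; have := ltn_ord v; lia.
by rewrite -pl => /mapP[y yl /val_inj/perm_inj xy]; rewrite xy yl in xl.
Qed.

(** Placing the elements outside [S] last, one by one, yields the factors n, n - 1, and so on. *)
Lemma dvdn_card_isolated : n ^_ (n - #|S|) %| #|[set s | P s]|.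
Proof.
have step (l : seq 'I_n) : uniq l -> {subset l <= ~: S} -> 
    #|[set s | P s]| = n ^_ (size l) * #|[set s | P s & placed_last l s]|.
  elim: l => [_ _|x l IH /= /andP[xl ul] sub].
    by rewrite mul1n; apply: eq_card => s; rewrite !inE /placed_last /= andbT.
  have xS : x \notin S by have := sub x; rewrite !inE eqxx => /(_ isT).
  have ln : size l < n.
    have /card_uniqP sz : uniq (x :: l) by rewrite /= xl.
    by have := max_card (mem (x :: l)); rewrite sz card_ord.
  rewrite IH // => [|y yl]; last by apply: sub; rewrite inE yl orbT.
  by rewrite (card_placed_cons xS) // mulnA ffactnSr.
rewrite (step (enum (~: S))) ?enum_uniq // => [|x]; last by rewrite mem_enum.
rewrite -cardE; have := cardsC S; rewrite card_ord => cS.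
have -> : n - #|S| = #|~: S| by lia.
exact: dvdn_mulr.
Qed.

End IsolatedElements.

End Permutations.

(** * Bounds and divisibility for the number of linear extensions *)

Section Poset.

Variables (n : nat) (R : {set 'I_n * 'I_n}).
Hypothesis posetR : is_poset R.

Lemma poset_refl x : (x, x) \in R.
Proof. by case/and3P: posetR => /forallP. Qed.

Lemma poset_anti x y : (x, y) \in R -> (y, x) \in R -> x = y.
Proof.
case/and3P: posetR => _ /forallP/(_ x)/forallP/(_ y)/implyP H _ xy yx.
by apply/eqP/H; rewrite xy.
Qed.

Lemma poset_trans x y z : (x, y) \in R -> (y, z) \in R -> (x, z) \in R.
Proof.
case/and3P: posetR => _ _ /forallP/(_ x)/forallP/(_ y)/forallP/(_ z)/implyP H xy yz.
by apply: H; rewrite xy.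
Qed.

Definition support : {set 'I_n} :=
  [set x | [exists y, (x != y) && (((x, y) \in R) || ((y, x) \in R))]].

Lemma in_support x y : (x, y) \in R -> x != y -> (x \in support) && (y \in support).
Proof.
move=> xy nxy; rewrite !inE; apply/andP; split; apply/existsP.
  by exists y; rewrite nxy xy.
by exists x; rewrite eq_sym nxy xy orbT.
Qed.

Definition minimal x := [forall z, ((z, x) \in R) ==> (z == x)].

Definition min_lt : rel 'I_n := fun x y => [&& minimal x, x != y & (x, y) \in R].

(* Keeping only the relations out of minimal elements makes every star of the
   comparability graph have its center below, or above, all its leaves. *)
Lemma min_lt_bipartite : bipartite min_lt.
Proof.
move=> x y z /and3P[_ xy Rxy]; apply/negP => /and3P[/forallP/(_ x)].
by rewrite Rxy (negPf xy).
Qed.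

(** Among the elements below [x], one with the fewest elements below it is minimal. *)
Lemma minimal_below x : exists2 z, minimal z & (z, x) \in R.
Proof.
pose f z := #|[set y | (y, z) \in R]|.
have [z zx minz] := arg_minnP (P := fun z => (z, x) \in R) f (poset_refl x).
exists z => //; apply/forallP => y; apply/implyP => yz.
apply/negPn/negP => nyz; have := minz y (poset_trans yz zx).
rewrite leqNgt => /negP[]; apply: proper_card; apply/properP; split.
  by apply/subsetP => w; rewrite !inE => wy; apply: poset_trans yz.
exists z; rewrite !inE ?poset_refl //.
by apply: contraNN nyz => zy; rewrite (poset_anti yz zy).
Qed.

Lemma support_covered : covered (sym_closure min_lt) support.
Proof.
move=> x xS; have [mx|nmx] := boolP (minimal x).
  move: xS; rewrite inE => /existsP[y /andP[xy /orP[Rxy|Ryx]]]; last first.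
    by move/forallP/(_ y): mx; rewrite Ryx eq_sym (negPf xy).
  exists y; first by case/andP: (in_support Rxy xy).
  by rewrite /sym_closure /min_lt mx xy Rxy.
have [z mz Rzx] := minimal_below x.
have zx : z != x by apply: contraNneq nmx => <-.
exists z; first by case/andP: (in_support Rzx zx).
by rewrite /sym_closure /min_lt mz zx Rzx orbT.
Qed.

Lemma linext_resp s : is_linext R s -> resp min_lt support s.
Proof.
move=> /forallP H; apply/forall_inP => x _; apply/forall_inP => y _.
by apply/implyP => /and3P[_ _]; apply/implyP/(forallP (H x)).
Qed.

Lemma ext_le_resp : ext R <= #|[set s | resp min_lt support s]|.
Proof. exact/leq_card_pred/linext_resp. Qed.

Lemma ext_upper : support != set0 -> #|support| * ext R <= n`!.
Proof.
move=> S0; apply: leq_trans (card_resp_covered min_lt_bipartite S0 support_covered).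
by rewrite leq_mul2l ext_le_resp orbT.
Qed.

Lemma ext_support0 : support = set0 -> ext R = n`!.
Proof.
move=> S0; rewrite -card_permT; apply: eq_card => s; rewrite !inE.
apply/forallP => x; apply/forallP => y; apply/implyP => Rxy.
have [->//|xy] := eqVneq x y.
by have := in_support Rxy xy; rewrite S0 inE.
Qed.

(** Every linear extension makes [c] extremal in the support. A relation avoiding [c] costs a
    further factor 2; without one, extremality of [c] suffices. *)
Lemma ext_star b c : c \in support ->
  {in support, forall a, a != c -> if b then (c, a) \in R else (a, c) \in R} ->
  #|support| * ext R = n`! \/ #|support|.*2 * ext R <= n`!.
Proof.
move=> cS star.
have cardT F : {in support, forall a s, F (tperm c a * s)%g = F s} -> _ :=
  @card_extremal n F b support c cS.
have sumT := cardT predT (fun _ _ _ => erefl); rewrite card_permT in sumT.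
have ext_extremal s : is_linext R s -> extremal b support c s.
  move=> /forallP H; apply/forall_inP => a aS.
  have [->|ac] := eqVneq a c; first by rewrite /dir_leq; case: b {star cardT sumT}.
  have := star a aS ac; rewrite /dir_leq; case: b {star cardT sumT} => Ra.
    exact: (implyP (forallP (H c) a)).
  exact: (implyP (forallP (H a) c)).
have [/existsP[x /existsP[y /and4P[xc yc xy Rxy]]]|none] :=
    boolP [exists x, exists y, [&& x != c, y != c, x != y & (x, y) \in R]].
  right; have /andP[xS yS] := in_support Rxy xy.
  (* Exchanging [x] and [y] keeps [c] extremal, so [x] precedes [y] in half of these orders. *)
  have half : 2 * ext R <= #|[set s | extremal b support c s]|.
    have swap_inv : {in [set x; y], forall a s,
        extremal b support c (tperm x a * s)%g = extremal b support c s}.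
      move=> a; rewrite !inE => axy s.
      have tc : tperm x a c = c.
        by rewrite tpermD //; case/orP: axy => /eqP->.
      have tS z : z \in support -> tperm x a z \in support.
        by case: tpermP => // _ _; case/orP: axy => /eqP->.
      apply/forall_inP/forall_inP => H z zS; last by rewrite !permM tc H // tS.
      by have := H _ (tS _ zS); rewrite !permM tc tpermK.
    rewrite -(@card_extremal n _ true _ _ (set21 x y) swap_inv).
    rewrite cards2 xy leq_mul2l; apply: leq_card_pred => s sR.
    rewrite ext_extremal //=; apply/forall_inP => a; rewrite !inE /dir_leq.
    move=> /orP[]/eqP-> //; exact: (implyP (forallP (forallP sR x) y)).
  rewrite -muln2 -mulnA -sumT leq_mul2l; apply/orP; right.
  by apply: leq_trans half _; apply: leq_card_pred.
left; rewrite -sumT; congr (_ * _); apply: eq_card => s; rewrite !inE /=.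
apply/idP/idP => [/ext_extremal//|/forall_inP H].
apply/forallP => x; apply/forallP => y; apply/implyP => Rxy.
have [->//|xy] := eqVneq x y; have /andP[xS yS] := in_support Rxy xy.
have [xc|xc] := eqVneq x c.
  subst x; have := star y yS; rewrite eq_sym xy => /(_ isT).
  have := H y yS; rewrite /dir_leq; case: b {star cardT sumT ext_extremal H} => // _ Ryc.
  by case/negP: xy; rewrite (poset_anti Rxy Ryc).
have [yc|yc] := eqVneq y c.
  subst y; have := star x xS xy.
  have := H x xS; rewrite /dir_leq; case: b {star cardT sumT ext_extremal H} => // _ Rcx.
  by case/negP: xy; rewrite (poset_anti Rxy Rcx).
case/negP: none; apply/existsP; exists x; apply/existsP; exists y.
by rewrite xc yc xy.
Qed.

Lemma ext_upper_strict : 5 <= #|support| ->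
  #|support| * ext R = n`! \/ #|support|.+1 * ext R <= n`!.
Proof.
move=> S5.
have [H|[c cS [b star]]] :=
    card_resp_covered_strict min_lt_bipartite S5 support_covered.
  by right; apply: leq_trans H; rewrite leq_mul2l ext_le_resp orbT.
have [|H|H] := @ext_star b c cS; [|by left|right].
  by move=> a aS ac; have := star a aS ac; case: (b) => /and3P[].
by apply: leq_trans H; rewrite leq_mul2r; apply/orP; right; lia.
Qed.

(** Relations between distinct elements stay inside the support, so only its relative order
    matters. *)
Lemma dvdn_ext : n ^_ (n - #|support|) %| ext R.
Proof.
apply: dvdn_card_isolated => s t H.
apply: eq_forallb => x; apply: eq_forallb => y.
have [Rxy|//] := boolP ((x, y) \in R).
have [->|xy] := eqVneq x y; first by rewrite !leqnn.
by have /andP[xS yS] := in_support Rxy xy; rewrite H.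
Qed.

End Poset.

(** * Counting the candidate values *)

(* m is the number of non-isolated elements: m = 0 gives n!, m = n - 1 only
   gives the star value, and m = 1 and m = n do not occur. *)
Definition LE_candidates (n : nat) : seq nat :=
  n`! :: (n * (n - 2)`!) ::
  [seq n ^_ (n - m) * e | m <- iota 2 (n - 3),
     e <- iota (m`! %/ n).+1 ((m.-1)`! - m`! %/ n)].

Lemma in_LE_candidates n v : 8 <= n -> (n.-1)`! < v -> in_LE n v ->
  v \in LE_candidates n.
Proof.
move=> n8 ltv /existsP[R /andP[posR /eqP extR]].
pose m := #|support R|.
have mn : m <= n by rewrite -[X in _ <= X](card_ord n) max_card.
have factn : n`! = n * (n.-1)`! by case: (n) n8 => // k _; rewrite factS.
have nv : n`! < n * v by rewrite factn ltn_mul2l ltv andbT; lia.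
have [S0|S0] := eqVneq (support R) set0.
  by rewrite -extR (ext_support0 S0) /LE_candidates mem_head.
have m1 : 1 < m.
  have irr := sym_closure_irr (min_lt_bipartite (R := R)).
  exact: covered_card_gt1 irr S0 (support_covered posR).
have m0 : 0 < m := ltnW m1.
have mv : m * v <= n`! by rewrite -extR ext_upper.
have ltmn : m < n.
  by rewrite ltn_neqAle mn andbT; apply: contraTneq mv => ->; rewrite -ltnNge.
rewrite !inE; have [m_pred|nm_pred] := eqVneq m n.-1.
  (* Either (n - 1) * v = n!, which determines [v], or n * v <= n!, against [nv]. *)
  have [|H|H] := @ext_upper_strict n R posR; rewrite -/m ?extR; first lia.
    have fn2 : (n.-1)`! = n.-1 * (n - 2)`!.
      by case: (n) n8 => // -[|k] // _; rewrite factS subn2.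
    apply/orP; right; apply/orP; left; rewrite -(@eqn_pmul2l n.-1); last lia.
    by apply/eqP; rewrite -{1}m_pred -extR H factn fn2; lia.
  by move: H; rewrite -/m extR m_pred prednK; lia.
apply/orP; right; apply/orP; right.
have /dvdnP[e ve] := dvdn_ext R; rewrite -/m extR mulnC in ve.
have factE : n`! = n ^_ (n - m) * m`!.
  by rewrite -(ffact_fact (leq_subr m n)) subKn.
have ff0 : 0 < n ^_ (n - m) by rewrite ffact_gt0 leq_subr.
apply/allpairsPdep; exists m, e; split=> //; first by rewrite mem_iota; lia.
have factm : m`! = m * (m.-1)`! by case: (m) m0 => // k _; rewrite factS.
(* The upper bound on [e] comes from [mv], the lower bound from [nv]. *)
have e_le : e <= (m.-1)`!.
  rewrite -(leq_pmul2l m0) -factm -(leq_pmul2l ff0) -factE.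
  by apply: leq_trans mv; rewrite ve; lia.
have lt_e : m`! %/ n < e.
  rewrite ltn_divLR; last lia.
  by rewrite -(ltn_pmul2l ff0) -factE mulnA -ve mulnC.
by rewrite mem_iota lt_e /=; lia.
Qed.

Lemma sum_fact_le k : \sum_(1 <= i < k.+1) i`! <= 2 * k`!.
Proof.
elim: k => [|k IH]; first by rewrite big_geq.
rewrite big_nat_recr //= factS; case: k IH => [|k] IH; first by rewrite big_geq.
by move: (_`!) IH => f IH; nia.
Qed.

(** The term m = n - 2 is (n - 3)! - q with q the floor of (n - 2)!/n, and the smaller m contribute
    at most 2 * (n - 4)!. So q has to exceed 2 * (n - 4)! + 2. *)
Lemma size_LE_candidates n : 8 <= n -> size (LE_candidates n) < (n - 3)`!.
Proof.
move=> n8; rewrite /LE_candidates /= size_allpairs_dep.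
have -> : [seq size (iota (m`! %/ n).+1 (m.-1`! - m`! %/ n)) | m <- iota 2 (n - 3)]
        = [seq m.-1`! - m`! %/ n | m <- iota 2 (n - 3)].
  by apply: eq_map => m; rewrite size_iota.
rewrite sumnE big_map.
have [k nk] : exists k, n = k.+4.+4 by exists (n - 8); lia.
have -> : iota 2 (n - 3) = index_iota 2 (k.+2.+4).+1.
  by rewrite /index_iota; congr iota; lia.
rewrite big_nat_recr //=.
have S : \sum_(2 <= i < k.+2.+4) ((i.-1)`! - i`! %/ n) <= 2 * (k.+4)`!.
  apply: leq_trans (sum_fact_le k.+4); rewrite big_add1 /=.
  by apply: leq_sum => i _; apply: leq_subr.
have -> : n - 3 = k.+4.+1 by lia.
set q := (k.+2.+4)`! %/ n.
have qE : (k.+2.+4)`! < q.+1 * n by rewrite ltn_ceil; lia.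
have f24 : 24 <= (k.+4)`! by apply: (@leq_fact 4); lia.
have f5 : (k.+4.+1)`! = k.+4.+1 * (k.+4)`! by rewrite factS.
have f6 : (k.+2.+4)`! = k.+2.+4 * (k.+4.+1)`! by rewrite factS.
rewrite f6 nk in qE.
(* Here (n - 2)/n >= 3/4 because n >= 8. *)
have q_ge : 3 * (k.+4.+1)`! <= 4 * q.+1.
  by move: (_`!) q qE => f q qE; nia.
move: S q_ge f24 {qE}; rewrite f5.
by move: (\sum_(2 <= i < _) _) (_`!) q => S f q; nia.
Qed.

Theorem theorem1p3 (n : nat) (hn : 8 <= n) :
  card_LE_in n (n.-1)`! n`! < (n - 3)`!.
Proof.
apply: leq_ltn_trans (size_LE_candidates hn).
(* The attained values are listed without repetition, so the length of the candidate list bounds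
   their number even if candidates repeat. *)
rewrite /card_LE_in -size_filter; apply: uniq_leq_size.
  exact/filter_uniq/iota_uniq.
move=> v; rewrite mem_filter mem_iota => /andP[vLE /andP[ltv _]].
exact: in_LE_candidates.
Qed.
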